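(* Let $G=\{\alpha\in\mathbb{R} : \alpha\in\mathbb{Q}\ \text{or}\ a_n(\alpha)\to\infty \text{ as } n\to\infty\}$, where $a_n(\alpha)$ denotes the $n$th partial quotient of the continued fraction expansion of $\alpha$. For every $\alpha\in\mathbb{R}$ there exist $\beta,\gamma\in G$ such that $\alpha=\beta+\gamma$.
   Context: Every irrational real $\alpha$ has a unique infinite continued fraction expansion $\alpha=[a_0;a_1,a_2,\ldots]=a_0+\cfrac{1}{a_1+\cfrac{1}{a_2+\cdots}}$ with $a_0\in\mathbb{Z}$ and $a_i$ positive integers for $i\ge1$; $a_n(\alpha):=a_n$ for $n\geq 1$. *)

(* Defs.v *)
From HB Require Import structures.
From mathcomp Require Import all_boot all_order all_algebra.
From mathcomp Require Import all_classical all_reals all_analysis.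

Set Implicit Arguments.
Unset Strict Implicit.
Unset Printing Implicit Defensive.

Import Order.TTheory GRing.Theory Num.Theory.
Import numFieldNormedType.Exports.

Local Open Scope classical_set_scope.
Local Open Scope ring_scope.

(* [a_0; a_1, ..., a_n], with n.+1 partial quotients. *)
Fixpoint convergent (R : realType) (a : nat -> int) (n : nat) : R :=
  if n is m.+1 then (a 0%N)%:~R + (convergent R (fun i => a i.+1) m)^-1
  else (a 0%N)%:~R.

Definition cf_expansion (R : realType) (alpha : R) (a : nat -> int) : Prop :=
  (forall i : nat, (0 < i)%N -> 0 < a i) /\
  convergent R a n @[n --> \oo] --> alpha.

(* An irrational alpha has exactly one cf_expansion, so a below is the sequence
   of partial quotients of alpha. *)
Definition G (R : realType) : set R :=
  [set alpha | rational alpha \/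
     exists2 a : nat -> int, cf_expansion alpha a &
       ((a n)%:~R : R) @[n --> \oo] --> +oo].

(* Main.v *)
Require Import Defs.
From mathcomp Require Import all_boot all_order all_algebra.
From mathcomp Require Import all_classical all_reals all_analysis.
From mathcomp Require Import ring lra zify.

Import Order.TTheory GRing.Theory Num.Theory.
Import numFieldNormedType.Exports.

Local Open Scope classical_set_scope.
Local Open Scope ring_scope.

(** If [alpha] is rational, write [alpha = alpha + 0]. Otherwise two finite
continued fractions [x] and [y] are prolonged greedily, in turn, so that the sum
of their values tends to [alpha] and the new partial quotients grow.

Let [q] and [s] be the denominators of [x] and [y] and [D] the absolute value of
[alpha - value x - value y] (the defect). A further partial quotient [d] moves
[value x] by [1 / (q * q1)], where [q1] is the new denominator, in a direction
fixed by the parity of the length of [x]. Let [t] be the real value of [d] for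
which the move equals [D]. The quality of the pair is [W = 1 / (q * s * D)]. It
obeys an exact law: taking for [d] an integer next to [t], above or below,
divides [W] by the distance from [t] to [d]. Hence [W] never decreases. Moreover
[q1] is about [W * s], so after the step [x] has by far the larger denominator
and it is the turn of [y], with large partial quotients as long as [W] is large.

Which of the two roundings is possible is dictated by the parities, since the
remaining defect must have the sign that [y] can correct. When the parities agree
it must be the ceiling; then they differ and the next rounding, on [y], must be
the floor. The danger is that [W] converges, all distances being close to 1. But
if the distance from [t] to its ceiling exceeds [1 - 1 / W], then [t] is within
[1 / W] of its floor, and two floor steps in a row on [x] have the right parity
too: the first one multiplies [W] by at least [W], and the second partial
quotient is about the inverse of the fractional part of [t], so it is large as
well. In the other case the ceiling turns [W] into at least
[W / (1 - 1 / W) >= W + 1]. Either way [W] grows by 1 at least in each round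
([ready_step]). The rounds start with [W >= 2] ([ready_start]) and both
truncations are prolonged infinitely often ([ready_round]); as [W] bounds the new
partial quotients from below and [1 / W] bounds the defect from above, the two
limits are in [G] ([limit_in_G]) and their sum is [alpha] ([ready_approx]). *)

(** * Convergents and their denominators *)

(** The numerators and the denominators of the convergents obey the same linear
recurrence. They are stored with a shift of one: with initial values
[(0, 1)], the entry [n.+1] is the denominator of [convergent R a n], and the
entry [0] is the conventional denominator 0 of the convergent of index -1. *)
Fixpoint continuant (R : realType) (x y : R) (a : nat -> int) (n : nat) : R :=
  if n is (m.+1 as k).+1 then
    (a k)%:~R * continuant R x y a k + continuant R x y a m
  else if n is 1%N then y else x.

Arguments continuant {R} x y a n : simpl never.

Definition positive_tail (a : nat -> int) := forall i, (0 < i)%N -> 0 < a i.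

Section Continuants.
Context {R : realType}.
Implicit Types (x y c : R) (a b : nat -> int) (n : nat).

Lemma continuantSS x y a n :
  continuant x y a n.+2 =
    (a n.+1)%:~R * continuant x y a n.+1 + continuant x y a n.
Proof. by []. Qed.

Lemma two_step_ind (P : nat -> Prop) :
  P 0%N -> P 1%N -> (forall n, P n -> P n.+1 -> P n.+2) -> forall n, P n.
Proof.
move=> P0 P1 PS n; suff: P n /\ P n.+1 by case.
by elim: n => [|n [? ?]]; split => //; exact: PS.
Qed.

(** [convergent] peels partial quotients off the front whereas [continuant]
appends them at the end; moving the first step of the recurrence into the
initial values reconciles the two. *)
Lemma continuant_shift x y a n :
  continuant x y a n.+1 =
    continuant y ((a 1%N)%:~R * y + x) (fun i => a i.+1) n.
Proof.
elim/two_step_ind: n => [//|//|n IH0 IH1].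
by rewrite continuantSS IH0 IH1 -continuantSS.
Qed.

Lemma continuant_linear c x y x' y' a n :
  continuant (c * x + x') (c * y + y') a n =
    c * continuant x y a n + continuant x' y' a n.
Proof.
elim/two_step_ind: n => [//|//|n IH0 IH1].
by rewrite !continuantSS IH0 IH1; ring.
Qed.

Lemma eq_continuant x y a b n : (forall i, (i < n)%N -> a i = b i) ->
  continuant x y a n = continuant x y b n.
Proof.
elim/two_step_ind: n => [//|//|n IH0 IH1] ab.
rewrite !continuantSS ab // IH0 ?IH1 // => i ?; apply: ab; lia.
Qed.

Lemma partial_quotient_ge1 a i : positive_tail a -> (0 < i)%N ->
  1 <= (a i)%:~R :> R.
Proof. by move=> a_gt0 i_gt0; rewrite ler1z -gtz0_ge1 a_gt0. Qed.

Lemma denominator_ge1 a n : positive_tail a -> 1 <= continuant 0 1 a n.+1 :> R.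
Proof.
move=> a_gt0; elim/two_step_ind: n => [//|| n IH0 IH1].
  by rewrite continuantSS /continuant mulr1 addr0 partial_quotient_ge1.
rewrite continuantSS ler_wpDr ?(le_trans ler01) // -[leLHS]mulr1.
by rewrite ler_pM // partial_quotient_ge1.
Qed.

Lemma denominator_gt0 a n : positive_tail a -> 0 < continuant 0 1 a n.+1 :> R.
Proof. by move=> a_gt0; rewrite (lt_le_trans ltr01) ?denominator_ge1. Qed.

Lemma denominator_ge0 a n : positive_tail a -> 0 <= continuant 0 1 a n :> R.
Proof. by case: n => [//|n] a_gt0; rewrite ltW ?denominator_gt0. Qed.

Lemma convergentE a n : positive_tail a ->
  convergent R a n =
    continuant 1 (a 0%N)%:~R a n.+1 / continuant 0 1 a n.+1.
Proof.
elim: n a => [|n IHn] a a_gt0; first by rewrite /continuant /= divr1.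
have sa_gt0 : positive_tail (fun i => a i.+1) by move=> i _; exact: a_gt0.
rewrite /= IHn // invf_div.
rewrite [in RHS]continuant_shift [X in _ = _ / X]continuant_shift mulr1 addr0.
have -> : continuant (a 0%N)%:~R ((a 1%N)%:~R * (a 0%N)%:~R + 1)
    (fun i => a i.+1) n.+1 =
  (a 0%N)%:~R * continuant 1 (a 1%N)%:~R (fun i => a i.+1) n.+1
    + continuant 0 1 (fun i => a i.+1) n.+1 :> R.
  by rewrite -continuant_linear mulr1 addr0 mulrC.
have : continuant 1 (a 1%N)%:~R (fun i => a i.+1) n.+1 != 0 :> R.
  have := denominator_gt0 a n.+1 a_gt0.
  by rewrite continuant_shift mulr1 addr0 => /lt0r_neq0.
by move=> ?; field.
Qed.

(** The difference of consecutive convergents has numerator 1 in absolute value;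
this determinant is the reason. *)
Lemma continuant_det a n :
  continuant 1 (a 0%N)%:~R a n.+1 * continuant 0 1 a n
    - continuant 1 (a 0%N)%:~R a n * continuant 0 1 a n.+1 = (-1) ^+ n.+1 :> R.
Proof.
elim: n => [|n IHn]; first by rewrite /continuant expr1; ring.
by rewrite !continuantSS exprS -IHn; ring.
Qed.

(** The only fact about convergents on which the construction rests: one more
partial quotient moves the convergent by the inverse of the product of two
consecutive denominators, in a direction that alternates. *)
Lemma convergent_step a n : positive_tail a ->
  convergent R a n.+1 - convergent R a n =
    (-1) ^+ n / (continuant 0 1 a n.+1 * continuant 0 1 a n.+2).
Proof.
move=> a_gt0; rewrite !convergentE //.
have := denominator_gt0 a n a_gt0; have := denominator_gt0 a n.+1 a_gt0.
move=> /lt0r_neq0 q1 /lt0r_neq0 q0.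
have -> : (-1) ^+ n = (-1) ^+ n.+2 :> R by rewrite !exprS; ring.
by rewrite -(continuant_det a); field; rewrite q0 q1.
Qed.

Lemma eq_convergent a b n : (forall i, (i <= n)%N -> a i = b i) ->
  convergent R a n = convergent R b n.
Proof.
elim: n a b => [|n IHn] a b ab /=; first by rewrite ab.
by rewrite ab // (IHn _ (fun i => b i.+1)) // => i ?; exact: ab.
Qed.

Lemma rational_convergent a n : rational (convergent R a n).
Proof.
elim: n a => [|n IHn] a /=; first by exists (a 0%N)%:~R => //; rewrite ratr_int.
have [r _ <-] := IHn (fun i => a i.+1).
by exists ((a 0%N)%:~R + r^-1) => //; rewrite rmorphD fmorphV /= ratr_int.
Qed.

(** Each product of two consecutive denominators is at least twice the preceding
one, so the increments of the convergents are dominated by a geometric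
series. *)
Lemma is_cvg_convergent a : positive_tail a -> cvgn (convergent R a).
Proof.
move=> a_gt0; pose q := continuant (0 : R) 1 a.
have q_ge0 n : 0 <= q n by exact: denominator_ge0.
have qD n : q n + q n.+1 <= q n.+2.
  by rewrite /q continuantSS addrC lerD2r ler_peMl ?q_ge0 ?partial_quotient_ge1.
have growth n : 2 ^+ n <= q n.+1 * q n.+2.
  elim: n => [|n IHn].
    by have := qD 0%N; rewrite expr0 /q /continuant /= add0r mul1r.
  rewrite exprS (le_trans (ler_wpM2l _ IHn)) //.
  have ? : 2 * q n.+1 <= q n.+3.
    by have := qD n.+1; have := qD n; have := q_ge0 n; lra.
  by rewrite mulrA [leRHS]mulrC ler_wpM2r.
suff cvg_tele : cvgn (series (telescope (convergent R a))).
  have -> : convergent R a =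
      (fun n => convergent R a 0%N + series (telescope (convergent R a)) n).
    by apply/funext => n; exact: eq_sum_telescope.
  by apply: is_cvgD => //; exact: is_cvg_cst.
apply: normed_cvg.
apply: (@series_le_cvg _ _ (geometric 1 (1 / 2))) => [n|n|n|].
- exact: normr_ge0.
- by rewrite /= mulr_ge0 ?exprn_ge0.
- change (`|convergent R a n.+1 - convergent R a n| <= 1 * (1 / 2) ^+ n).
  rewrite convergent_step // normrM normfV normrX normrN1 expr1n.
  rewrite !mul1r exprVn ger0_norm; last by rewrite mulr_ge0 ?q_ge0.
  by rewrite lef_pV2 ?posrE ?mulr_gt0 ?exprn_gt0 ?denominator_gt0 ?growth.
- by apply: is_cvg_geometric_series; rewrite ger0_norm; lra.
Qed.

End Continuants.

(** * Prolonging a finite continued fraction *)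

(** The pair [(a, n)] stands for the finite continued fraction
[a 0; a 1, ..., a n]. The values of [a] beyond [n] are junk, but keeping a total
function with positive tail lets the results on [convergent] apply as they
are. *)
Definition truncation : Type := (nat -> int) * nat.

Definition append (x : truncation) (d : int) : truncation :=
  (fun i => if i == x.2.+1 then d else x.1 i, x.2.+1).

(** The construction uses increasing values of [k] as it proceeds, which is what
sends the partial quotients to infinity. *)
Definition prolongs (k : nat) (x y : truncation) :=
  [/\ (x.2 <= y.2)%N, forall i, (i <= x.2)%N -> y.1 i = x.1 i
    & forall i, (x.2 < i <= y.2)%N -> k%:Z <= y.1 i].

Lemma prolongs_refl k x : prolongs k x x.
Proof. by split=> // i; lia. Qed.

Lemma prolongs_trans k x y z : prolongs k x y -> prolongs k y z -> prolongs k x z.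
Proof.
move=> [xy agree_xy large_xy] [yz agree_yz large_yz]; split.
- exact: leq_trans yz.
- by move=> i ix; rewrite agree_yz ?agree_xy //; exact: leq_trans xy.
- move=> i /andP[xi iz]; have [iy|yi] := leqP i y.2.
    by rewrite agree_yz // large_xy // xi.
  by rewrite large_yz // yi.
Qed.

Lemma prolongsW k l x y : (k <= l)%N -> prolongs l x y -> prolongs k x y.
Proof.
move=> kl [xy agree large]; split=> // i /large; apply: le_trans.
by rewrite lez_nat.
Qed.

Lemma prolongs_append k x d : k%:Z <= d -> prolongs k x (append x d).
Proof.
move=> kd; split=> /= [|i ix|i]; first exact: leqnSn.
  by rewrite ltn_eqF.
by rewrite -eqn_leq eq_sym => ->.
Qed.

Lemma positive_append x d : 0 < d -> positive_tail x.1 ->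
  positive_tail (append x d).1.
Proof. by move=> d_gt0 x_gt0 i i_gt0 /=; case: eqP => // _; exact: x_gt0. Qed.

Section Steps.
Context {R : realType}.
Implicit Types (x y : truncation) (d : int) (alpha : R).

Definition value x : R := convergent R x.1 x.2.
Definition den x : R := continuant 0 1 x.1 x.2.+1.
Definition prev_den x : R := continuant 0 1 x.1 x.2.

Lemma den_append x d : den (append x d) = d%:~R * den x + prev_den x.
Proof.
rewrite /den /prev_den [(append x d).2]/= continuantSS /= eqxx.
by congr (_ * _ + _); apply: eq_continuant => i ?; rewrite ltn_eqF //; lia.
Qed.

Lemma prev_den_append x d : prev_den (append x d) = den x.
Proof. by apply: eq_continuant => i ? /=; rewrite ltn_eqF. Qed.

Lemma den_gt0 x : positive_tail x.1 -> 0 < den x.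
Proof. exact: denominator_gt0. Qed.

Lemma prev_den_ge0 x : positive_tail x.1 -> 0 <= prev_den x.
Proof. exact: denominator_ge0. Qed.

Lemma prev_den_le x : positive_tail x.1 -> prev_den x <= den x.
Proof.
case: x => a [|n] /= a_gt0; first by rewrite /prev_den /den /continuant ler01.
rewrite /prev_den /den continuantSS ler_wpDr ?denominator_ge0 //.
by rewrite ler_peMl ?denominator_ge0 ?partial_quotient_ge1.
Qed.

Lemma value_append x d : 0 < d -> positive_tail x.1 ->
  value (append x d) = value x + (-1) ^+ x.2 / (den x * den (append x d)).
Proof.
move=> d_gt0 x_gt0.
have a_gt0 := positive_append _ _ d_gt0 x_gt0.
have := convergent_step (R := R) (append x d).1 x.2 a_gt0.
rewrite -[convergent R _ x.2.+1]/(value (append x d)).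
rewrite (eq_convergent _ x.1) => [|i ?]; last by rewrite /= ltn_eqF.
rewrite -/(value x) -[continuant _ _ _ x.2.+1]/(prev_den (append x d)).
rewrite prev_den_append -[continuant _ _ _ x.2.+2]/(den (append x d)).
by move=> <-; ring.
Qed.

(** What remains of [alpha], with the sign that makes the next step on [x]
possible: the next partial quotient of [x] moves [value x] in the direction
[(-1) ^+ x.2], so it helps exactly when the defect is positive. *)
Definition defect alpha x y : R := (-1) ^+ x.2 * (alpha - value x - value y).

Lemma defectC alpha x y : odd x.2 = odd y.2 -> defect alpha x y = defect alpha y x.
Proof. by move=> xy; rewrite /defect -signr_odd xy signr_odd; ring. Qed.

Lemma defect_append alpha x y d : 0 < d -> positive_tail x.1 ->
  defect alpha (append x d) y = (den x * den (append x d))^-1 - defect alpha x y.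
Proof.
move=> d_gt0 x_gt0; rewrite /defect value_append //= exprS.
have := signrMK x.2 ((den x * den (append x d))^-1).
by move=> {2}<-; ring.
Qed.

(** When the two indices have the same parity, appending to [x] flips the
direction of [x] but not that of [y]: undershooting on [x] leaves a positive
defect for [y], overshooting (see [defect_append]) one for [x] itself. *)
Lemma defect_append_right alpha x y d : 0 < d -> positive_tail x.1 ->
  odd x.2 = odd y.2 ->
  defect alpha y (append x d) = defect alpha x y - (den x * den (append x d))^-1.
Proof.
move=> d_gt0 x_gt0 xy; rewrite /defect value_append // -(signr_odd _ y.2) -xy.
rewrite signr_odd; have := signrMK x.2 ((den x * den (append x d))^-1).
by move=> {2}<-; ring.
Qed.

Lemma defect_neq0 alpha x y : ~ rational alpha -> defect alpha x y != 0.
Proof.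
move=> irr; apply/eqP => /eqP; rewrite mulf_eq0 signr_eq0 /=.
rewrite -addrA -opprD subr_eq0 => /eqP alphaE; apply: irr.
have [r _ rx] := rational_convergent (R := R) x.1 x.2.
have [s _ sy] := rational_convergent (R := R) y.1 y.2.
by exists (r + s) => //; rewrite rmorphD /= rx sy.
Qed.

(** Writing [D] for the defect and [q], [q1] for the old and the new denominator
of [x], the two inequalities say that [d] is the largest integer for which the
step [1 / (q * q1)] is at least [D]. Equality would make [alpha] a sum of two
rational numbers. *)
Lemma floor_digit alpha x y : ~ rational alpha -> positive_tail x.1 ->
  0 < defect alpha x y -> den x * (den x + prev_den x) * defect alpha x y <= 1 ->
  exists d, [/\ 0 < d, den x * den (append x d) * defect alpha x y < 1
             & 1 < den x * (den (append x d) + den x) * defect alpha x y].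
Proof.
move=> irr x_gt0; set D := defect _ _ _ => D_gt0 small.
have q_gt0 := den_gt0 _ x_gt0; have q'_ge0 := prev_den_ge0 _ x_gt0.
set q := den x in q_gt0 small *; set q' := prev_den x in q'_ge0 small *.
(* The complete quotient: the real value of [d] for which the step is [D]. *)
pose t := ((q * D)^-1 - q') / q.
have qD_gt0 : 0 < q * D by rewrite mulr_gt0.
have tE : (t * q + q') * (q * D) = 1.
  by rewrite /t; field; rewrite !gt_eqF.
have t_ge1 : 1 <= t.
  rewrite /t ler_pdivlMr // mul1r lerBrDr -(ler_pM2r qD_gt0) mulVf ?gt_eqF //.
  by have -> : (q + q') * (q * D) = q * (q + q') * D by ring.
have d_gt0 : 0 < Num.floor t by rewrite floor_gt0.
exists (Num.floor t); rewrite den_append -/q -/q'.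
have := floor_itv t; rewrite intrD => /andP[dt td].
split=> //.
- rewrite lt_neqAle; apply/andP; split; last first.
    have -> (u : R) : q * u * D = u * (q * D) by ring.
    rewrite -[leRHS]tE ler_wpM2r ?(ltW qD_gt0) // lerD2r.
    by rewrite ler_wpM2r // ltW.
  have : defect alpha (append x (Num.floor t)) y != 0 by exact: defect_neq0.
  rewrite defect_append // den_append -/q -/q' -/D; apply: contraNneq.
  move=> E; rewrite subr_eq0; apply/eqP.
  have q1_neq0 : q * ((Num.floor t)%:~R * q + q') != 0.
    by apply: contra_eq_neq E => ->; rewrite mul0r eq_sym oner_eq0.
  by rewrite -[LHS]mulr1 -[X in _ * X]E mulKf.
- have -> (u : R) : q * u * D = u * (q * D) by ring.
  rewrite -[ltLHS]tE ltr_pM2r //.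
  by rewrite addrAC ltrD2r -[X in _ + X]mul1r -mulrDl ltr_pM2r.
Qed.

End Steps.

(** * One round improves the quality of the approximation *)

Section Inequalities.
Context {R : realFieldType}.
Implicit Types q s D w : R.

(** In this section [D] is a defect, [q] and [q1] are the old and the new
denominator of the truncation that receives a partial quotient, and [s] is the
denominator of the other one. *)
Lemma floor_leaves_gt0 q q1 D : 0 < q -> 0 < q1 -> q * q1 * D < 1 ->
  0 < (q * q1)^-1 - D.
Proof.
move=> q_gt0 q1_gt0 below.
by rewrite subr_gt0 -[ltRHS]mul1r ltr_pdivlMr ?mulr_gt0 // mulrC.
Qed.

(** The product of the denominators and the defect never grows in a floor step;
this is why the quality of a pair is measured by it. *)
Lemma floor_shrinks q q1 D : 0 < q -> 0 < q1 -> 1 < q * (q1 + q) * D ->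
  q1 * ((q * q1)^-1 - D) < q * D.
Proof.
move=> q_gt0 q1_gt0 above; rewrite -(ltr_pM2l q_gt0).
have -> : q * (q1 * ((q * q1)^-1 - D)) = 1 - q * q1 * D.
  by field; rewrite !gt_eqF.
by lra.
Qed.

(** The hypothesis of [floor_digit] is automatic after a floor step: a complete
quotient exceeds 1. *)
Lemma floor_iterable q q1 D : 0 < q -> 0 < q1 -> 1 < q * (q1 + q) * D ->
  q1 * (q1 + q) * ((q * q1)^-1 - D) <= 1.
Proof.
move=> q_gt0 q1_gt0 above; rewrite -(ler_pM2l q_gt0).
have -> : q * (q1 * (q1 + q) * ((q * q1)^-1 - D))
    = q1 + q - q1 * (q * (q1 + q) * D).
  by field; rewrite !gt_eqF.
by have := ltr_pM2l q1_gt0 1 (q * (q1 + q) * D); rewrite above; lra.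
Qed.

(** A ceiling step uses the partial quotient following that of a floor step, that
is the denominator [q1 + q]. It multiplies [q * s * D] by the distance from the
complete quotient to its ceiling. The last hypothesis bounds this distance by
[1 - 1 / w], and [w / (1 - 1 / w) >= w + 1]. *)
Lemma ceil_gain q q1 s D w : 0 < q -> 0 < q1 -> 0 < s -> 0 < D -> 2 <= w ->
  w * (q * s * D) <= 1 -> w * (q * q1 * D) + q * q * D <= w ->
  (w + 1) * (s * (q1 + q) * (D - (q * (q1 + q))^-1)) <= 1.
Proof.
move=> q_gt0 q1_gt0 s_gt0 D_gt0 w_ge2 good far.
have w_gt0 : 0 < w by lra.
rewrite -(ler_pM2l (mulr_gt0 w_gt0 q_gt0)).
have -> : w * q * ((w + 1) * (s * (q1 + q) * (D - (q * (q1 + q))^-1)))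
    = (w + 1) * s * (w * (q * q1 * D) + w * (q * q * D) - w).
  by field; rewrite !gt_eqF ?addr_gt0.
have step : (w + 1) * s * (w * (q * q1 * D) + w * (q * q * D) - w)
    <= (w + 1) * s * ((w - 1) * (q * q * D)).
  by rewrite ler_wpM2l ?mulr_ge0 ?(ltW s_gt0) //; lra.
apply: le_trans step _.
have -> : (w + 1) * s * ((w - 1) * (q * q * D))
    = w * q * (w * (q * s * D)) - q * (q * s * D) by ring.
have : w * q * (w * (q * s * D)) <= w * q * 1 by rewrite ler_pM2l ?mulr_gt0.
have : 0 < q * (q * s * D) by rewrite !mulr_gt0.
by lra.
Qed.

(** The hypotheses read [w <= 1 / (q * s * D)] and [1 / (q * D) < u]. *)
Lemma large_step q u s D w : 0 < q -> 0 < D -> w * (q * s * D) <= 1 ->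
  1 < q * u * D -> w * s < u.
Proof.
move=> q_gt0 D_gt0 le1 lt1; rewrite -(ltr_pM2l (mulr_gt0 q_gt0 D_gt0)).
have -> : q * D * (w * s) = w * (q * s * D) by ring.
have -> : q * D * u = q * u * D by ring.
exact: le_lt_trans lt1.
Qed.

End Inequalities.

Section Growth.
Context {R : realType}.
Implicit Types (x y : truncation) (alpha w : R).

(** The invariant: it is the turn of [x], both truncations point in the same
direction, and the product of the two denominators and the defect is at most
[1 / w]. Together with this bound, the last condition makes the next partial
quotient of [x] positive and at least about [w]. *)
Definition ready alpha w x y :=
  [/\ [/\ positive_tail x.1, positive_tail y.1 & odd x.2 = odd y.2],
      0 < defect alpha x y,
      w * (den x * den y * defect alpha x y) <= 1
    & den x + prev_den x <= den y :> R].

Lemma large_digit k x (d : int) : positive_tail x.1 ->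
  k.+2%:R * den x < den (append x d) + den x :> R -> k%:Z <= d.
Proof.
move=> x_gt0; rewrite den_append => large.
have q_gt0 : 0 < den x :> R := den_gt0 _ x_gt0.
have := prev_den_le (R := R) _ x_gt0; set q := den x in q_gt0 large *.
move=> q'_le; suff : k%:Z < d by exact: ltW.
rewrite -(ltr_int R) -(ltr_pM2r q_gt0) -pmulrn.
have -> : k%:R * q = k.+2%:R * q - 2 * q by rewrite -addn2 natrD; ring.
by lra.
Qed.

(** Let [t] be the complete quotient that [x] needs to reach [alpha - value y]. If
[t] exceeds its floor by at least [1 / w], the ceiling of [t] is appended to
[x], which improves [w] to [w + 1], and then a floor step on [y] restores the
parities at no loss. Otherwise two floor steps on [x] are made: the second
complete quotient is the inverse of the fractional part of [t], hence larger
than [w], and since [x] gets the larger denominator the roles of [x] and [y] are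
exchanged. *)
Lemma ready_step alpha k x y : ~ rational alpha -> ready alpha k.+2%:R x y ->
  exists x', prolongs k x x' /\ (x.2 < x'.2)%N /\
    (ready alpha k.+3%:R y x' \/
     exists y', [/\ prolongs k y y', (y.2 < y'.2)%N & ready alpha k.+3%:R x' y']).
Proof.
move=> irr [[x_gt0 y_gt0 par] D_gt0 good room].
have q_gt0 := den_gt0 (R := R) _ x_gt0.
have q'_ge0 := prev_den_ge0 (R := R) _ x_gt0.
have s_gt0 := den_gt0 (R := R) _ y_gt0.
have s'_le := prev_den_le (R := R) _ y_gt0.
have w_ge2 : 2 <= k.+2%:R :> R by rewrite ler_nat.
have -> : k.+3%:R = k.+2%:R + 1 :> R by rewrite -addn1 natrD.
set w : R := k.+2%:R in good w_ge2 *.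
have [|d [d_gt0 below above]] := floor_digit alpha x y irr x_gt0 D_gt0.
  apply: le_trans (_ : den x * den y * defect alpha x y <= 1).
    by rewrite ler_pM2r // ler_pM2l.
  apply: le_trans good; rewrite ler_peMl //; last by lra.
  exact/ltW/mulr_gt0/D_gt0/mulr_gt0.
have x1_gt0 := positive_append _ _ d_gt0 x_gt0.
have q1_gt0 := den_gt0 (R := R) _ x1_gt0.
have ws_lt := large_step _ _ _ _ _ q_gt0 D_gt0 good above.
have wq_lt : w * den x < den (append x d) + den x.
  by apply: le_lt_trans ws_lt; rewrite ler_wpM2l //; lra.
have kd := large_digit _ _ _ x_gt0 wq_lt.
(* The comparison of the fractional part of [t] with [1 / w]. *)
have [far|near] := lerP (w * (den x * den (append x d) * defect alpha x y)
   + den x * den x * defect alpha x y) w.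
- have d1_gt0 : 0 < d + 1 by rewrite addr_gt0.
  have x2_gt0 := positive_append _ _ d1_gt0 x_gt0.
  have cE : den (append x (d + 1)) = den (append x d) + den x :> R.
    by rewrite !den_append intrD; ring.
  have D1E := defect_append_right alpha x y _ d1_gt0 x_gt0 par.
  have gain := ceil_gain _ _ _ _ _ q_gt0 q1_gt0 s_gt0 D_gt0 w_ge2 good far.
  rewrite -cE -D1E in gain; rewrite -cE in above ws_lt.
  set x2 := append x (d + 1) in x2_gt0 cE D1E gain above ws_lt.
  have c_gt0 := den_gt0 (R := R) _ x2_gt0.
  have D1_gt0 : 0 < defect alpha y x2.
    rewrite D1E subr_gt0 -[ltLHS]mul1r ltr_pdivrMr ?mulr_gt0 //.
    by rewrite mulrC.
  have two_s : 2 * den y <= w * den y by rewrite ler_wpM2r // ltW.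
  have scD1_ge0 : 0 <= den y * den x2 * defect alpha y x2.
    exact/ltW/mulr_gt0/D1_gt0/mulr_gt0.
  have [|e [e_gt0 below2 above2]] := floor_digit alpha y x2 irr y_gt0 D1_gt0.
    apply: le_trans (_ : den y * den x2 * defect alpha y x2 <= 1).
      by rewrite ler_pM2r // ler_pM2l //; lra.
    apply: le_trans gain; rewrite ler_peMl //; lra.
  have y2_gt0 := positive_append _ _ e_gt0 y_gt0.
  have s1_gt0 := den_gt0 (R := R) _ y2_gt0.
  have wc_lt : (w + 1) * den x2 < den (append y e) + den y.
    exact: large_step gain above2.
  have three_c : 3 * den x2 <= (w + 1) * den x2 by rewrite ler_wpM2r ?(ltW c_gt0) //; lra.
  exists x2; split; first by apply: prolongs_append; rewrite (le_trans kd) // lerDl.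
  split=> //; right; exists (append y e); split=> //.
    apply: prolongs_append; apply: (large_digit _ y) => //; rewrite -/w.
    apply: le_lt_trans wc_lt; rewrite ler_pM //; lra.
  have D2E := defect_append alpha y x2 _ e_gt0 y_gt0.
  rewrite /ready defectC; last by rewrite /= par.
  split=> //=.
  + by rewrite par.
  + by rewrite D2E floor_leaves_gt0.
  + have shrink := floor_shrinks _ _ _ s_gt0 s1_gt0 above2.
    rewrite -D2E in shrink.
    apply: le_trans gain; rewrite ler_wpM2l //; first by lra.
    rewrite -mulrA [den y * _]mulrC -mulrA ler_wpM2l ?(ltW c_gt0) //.
    exact: ltW.
  + by rewrite /x2 prev_den_append; lra.
- have D1E := defect_append alpha x y _ d_gt0 x_gt0.
  have iter := floor_iterable _ _ _ q_gt0 q1_gt0 above.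
  rewrite -D1E in iter.
  set x1 := append x d in x1_gt0 q1_gt0 ws_lt wq_lt D1E iter near above below.
  have D1_gt0 : 0 < defect alpha x1 y by rewrite D1E floor_leaves_gt0.
  have tiny : w * (den x1 * defect alpha x1 y) < den x * defect alpha x y.
    rewrite D1E -(ltr_pM2l q_gt0).
    have -> : den x * (w * (den x1 * ((den x * den x1)^-1 - defect alpha x y)))
      = w - w * (den x * den x1 * defect alpha x y).
      by field; rewrite !gt_eqF.
    by lra.
  have [|e [e_gt0 below2 above2]] := floor_digit alpha x1 y irr x1_gt0 D1_gt0.
    by rewrite prev_den_append.
  have x2_gt0 := positive_append _ _ e_gt0 x1_gt0.
  have q2_gt0 := den_gt0 (R := R) _ x2_gt0.
  have D2E := defect_append alpha x1 y _ e_gt0 x1_gt0.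
  have shrink := floor_shrinks _ _ _ q1_gt0 q2_gt0 above2.
  rewrite -D2E in shrink.
  exists (append x1 e); split.
    apply: prolongs_trans (prolongs_append _ _ _ kd) _.
    apply: prolongs_append; apply: (large_digit _ x1) => //; rewrite -/w.
    have w_lt : w < (den (append x1 e) + den x1) * (den x * defect alpha x y).
      have : w * 1 <
          w * (den x1 * (den (append x1 e) + den x1) * defect alpha x1 y).
        by rewrite ltr_pM2l //; lra.
      have : (den (append x1 e) + den x1) * (w * (den x1 * defect alpha x1 y)) <
             (den (append x1 e) + den x1) * (den x * defect alpha x y).
        by rewrite ltr_pM2l // addr_gt0.
      lra.
    have : den x1 * w < den x1 *
        ((den (append x1 e) + den x1) * (den x * defect alpha x y)).
      by rewrite ltr_pM2l.
    have : (den (append x1 e) + den x1) * (den x * den x1 * defect alpha x y)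
       < (den (append x1 e) + den x1) * 1 by rewrite ltr_pM2l // addr_gt0.
    lra.
  split; first by rewrite /= leqW.
  left; rewrite /ready defectC; last by rewrite /= negbK.
  split=> //=.
  + by rewrite negbK.
  + by rewrite D2E floor_leaves_gt0.
  + apply: le_trans (_ : (w + 1) * (den y * (den x1 * defect alpha x1 y)) <= 1).
      rewrite ler_wpM2l //; first by lra.
      by rewrite -mulrA ler_wpM2l // ltW.
    rewrite -(ler_pM2l (_ : 0 < w)); last by lra.
    have : (w + 1) * den y * (w * (den x1 * defect alpha x1 y))
        <= (w + 1) * den y * (den x * defect alpha x y).
      by rewrite ler_wpM2l ?(ltW tiny) // mulr_ge0 ?(ltW s_gt0) //; lra.
    have : den x * den y * defect alpha x y <= w * (den x * den y * defect alpha x y).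
      rewrite ler_peMl //; last by lra.
      exact/ltW/mulr_gt0/D_gt0/mulr_gt0.
    by lra.
  + have : 2 * den y <= w * den y by rewrite ler_wpM2r // ltW.
    have : den x1 <= e%:~R * den x1 :> R.
      by rewrite ler_peMl ?(ltW q1_gt0) // ler1z -gtz0_ge1.
    rewrite den_append /x1 prev_den_append -/x1.
    by lra.
Qed.

End Growth.

(** * Infinitely many rounds *)

Section Rounds.
Context {R : realType}.
Implicit Types (x y : truncation) (alpha w : R).

Lemma readyW alpha v w x y : v <= w -> ready alpha w x y -> ready alpha v x y.
Proof.
move=> vw [tails D_gt0 good room]; split=> //; apply: le_trans good.
have [x_gt0 y_gt0 _] := tails.
apply: ler_wpM2r vw; apply/ltW/mulr_gt0/D_gt0.
by rewrite mulr_gt0 // den_gt0.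
Qed.

Definition ready_pair alpha w (p : truncation * truncation) :=
  ready alpha w p.1 p.2 \/ ready alpha w p.2 p.1.

Definition advances k (p p' : truncation * truncation) :=
  [/\ prolongs k p.1 p'.1, (p.1.2 < p'.1.2)%N,
      prolongs k p.2 p'.2 & (p.2.2 < p'.2.2)%N].

(** [ready_step] may prolong [x] alone, but then the roles are exchanged and the
next step prolongs [y]. *)
Lemma ready_round alpha k x y : ~ rational alpha -> ready alpha k.+2%:R x y ->
  exists p, ready_pair alpha k.+3%:R p /\ advances k (x, y) p.
Proof.
move=> irr /(ready_step _ _ _ _ irr)[x1 [xx1 [ltx [|[y1 [yy1 lty ready1]]]]]];
  last by exists (x1, y1); split; [left|].
move=> /(ready_step _ _ _ _ irr)[y1 [yy1 [lty]]].
have k34 : k.+3%:R <= k.+4%:R :> R by rewrite ler_nat.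
move/(prolongsW _ _ _ _ (leqnSn k)) in yy1.
case=> [/(readyW _ _ _ _ _ k34)|[x2 [x12 ltx2 /(readyW _ _ _ _ _ k34) ready2]]].
  by exists (x1, y1); split; [left|].
exists (x2, y1); split; first by right.
split=> //=; last exact: ltn_trans ltx ltx2.
exact: prolongs_trans xx1 (prolongsW _ _ _ _ (leqnSn k) x12).
Qed.

Lemma ready_pair_round alpha k p : ~ rational alpha ->
  ready_pair alpha k.+2%:R p ->
  exists p', ready_pair alpha k.+3%:R p' /\ advances k p p'.
Proof.
case: p => x y irr [] /= /(ready_round _ _ _ _ irr); first by [].
move=> [[y' x'] [ready' [? ? ? ?]]]; exists (x', y'); split=> //.
by rewrite /ready_pair or_comm.
Qed.

(** If the fractional part [f] of [alpha] is at most 1/2, the integers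
[floor alpha] and 0 do. Otherwise two floor steps on 0 towards [f] leave a
defect whose product with the new denominator is at most [1 - f]. *)
Lemma ready_start alpha : ~ rational alpha -> exists p, ready_pair alpha 2 p.
Proof.
move=> irr.
pose x : truncation := (fun i => if i == 0%N then Num.floor alpha else 1, 0%N).
pose y : truncation := (fun i => if i == 0%N then 0 else 1, 0%N).
have x_gt0 : positive_tail x.1 by case.
have y_gt0 : positive_tail y.1 by case.
have DE : defect alpha x y = alpha - (Num.floor alpha)%:~R.
  by rewrite /defect /value /= mul1r subr0.
have D_gt0 : 0 < defect alpha x y.
  by rewrite lt_neqAle eq_sym defect_neq0 //= DE subr_ge0 floor_le.
have den1 (z : truncation) : z.2 = 0%N -> den z = 1 :> R /\ prev_den z = 0 :> R.
  by rewrite /den /prev_den => ->.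
have [qx qx'] := den1 x erefl; have [qy qy'] := den1 y erefl.
have [small|large] := lerP (defect alpha x y) (1 / 2).
  exists (x, y); left; split=> //=; first by rewrite qx qy; lra.
  by rewrite qx qx' qy addr0.
have D_lt1 : defect alpha x y < 1.
  by rewrite DE ltrBlDl; have /andP[_] := floor_itv alpha; rewrite intrD.
rewrite defectC // in DE D_gt0 large D_lt1.
have [|d [d_gt0 below above]] := floor_digit alpha y x irr y_gt0 D_gt0.
  by rewrite qy qy' addr0 !mul1r ltW.
have y1_gt0 := positive_append _ _ d_gt0 y_gt0.
have q1_ge1 : 1 <= den (append y d) :> R by exact: denominator_ge1.
have q1_gt0 : 0 < den (append y d) :> R by exact: den_gt0.
have q_gt0 : 0 < den y :> R by exact: den_gt0.
have D1E := defect_append alpha y x _ d_gt0 y_gt0.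
have iter := floor_iterable _ _ _ q_gt0 q1_gt0 above.
rewrite -D1E in iter.
have D1_gt0 : 0 < defect alpha (append y d) x.
  by rewrite D1E floor_leaves_gt0.
have [|e [e_gt0 below2 above2]] := floor_digit alpha _ x irr y1_gt0 D1_gt0.
  by rewrite prev_den_append.
have y2_gt0 := positive_append _ _ e_gt0 y1_gt0.
have q2_gt0 : 0 < den (append (append y d) e) :> R by exact: den_gt0.
have D2E := defect_append alpha (append y d) x _ e_gt0 y1_gt0.
have shrink := floor_shrinks _ _ _ q1_gt0 q2_gt0 above2.
rewrite -D2E in shrink.
exists (x, append (append y d) e); left.
rewrite /ready /= defectC //; split=> //.
- by rewrite D2E floor_leaves_gt0.
- have : den (append y d) * defect alpha (append y d) x
      = 1 - den (append y d) * defect alpha y x.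
    by rewrite D1E qy; field; rewrite gt_eqF.
  have : 1 * defect alpha y x <= den (append y d) * defect alpha y x.
    by rewrite ler_pM2r.
  by rewrite qx; lra.
- by rewrite qx qx' addr0; exact: denominator_ge1.
Qed.

Lemma ready_approx alpha k p : ready_pair alpha k.+2%:R p ->
  `|alpha - (value p.1 + value p.2)| <= harmonic k.
Proof.
wlog : p / ready alpha k.+2%:R p.1 p.2 => [hwlog [] ready_p|[tails D_gt0 good _] _].
- by apply: hwlog => //; left.
- by rewrite [value p.1 + _]addrC; apply: (hwlog (p.2, p.1)) => //; left.
have [x_gt0 y_gt0 _] := tails.
have -> : `|alpha - (value p.1 + value p.2)| = defect alpha p.1 p.2.
  rewrite -[RHS]gtr0_norm // normrM normrX normrN1 expr1n mul1r opprD addrA //.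
rewrite -[leRHS]mul1r ler_pdivlMr ?ltr0n //; apply: le_trans good.
rewrite mulrC ler_pM ?(ltW D_gt0) ?ler_nat //.
rewrite ler_peMl ?(ltW D_gt0) //.
by rewrite -[leLHS]mulr1 ler_pM ?denominator_ge1.
Qed.

Lemma limit_digits (u : nat -> truncation) :
  (forall k, positive_tail (u k).1) ->
  (forall k, prolongs k (u k) (u k.+1)) ->
  (forall k, (u k).2 < (u k.+1).2)%N ->
  exists a : nat -> int, [/\ positive_tail a,
    ((a n)%:~R : R) @[n --> \oo] --> +oo
    & forall k i, (i <= (u k).2)%N -> a i = (u k).1 i].
Proof.
move=> u_gt0 u_prolongs u_lt.
have u_ge k : (k <= (u k).2)%N by elim: k => // k /leq_ltn_trans; apply.
have u_chain k l : (k <= l)%N -> prolongs k (u k) (u l).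
  elim: l => [|l IHl]; first by rewrite leqn0 => /eqP ->; exact: prolongs_refl.
  rewrite leq_eqVlt => /predU1P[->|kl]; first exact: prolongs_refl.
  by apply: prolongs_trans (IHl kl) _; exact: prolongsW (u_prolongs l).
(* The index of [u i] is at least [i], so its entry [i] is final. *)
exists (fun i => (u i).1 i).
have agree k i : (i <= (u k).2)%N -> (u i).1 i = (u k).1 i.
  move=> ik; have [ki|/ltnW ki] := leqP k i.
    by have [_ /(_ i ik)] := u_chain _ _ ki.
  by have [_ /(_ i (u_ge i))] := u_chain _ _ ki.
split=> //; first by move=> i; exact: u_gt0.
apply/cvgryPge => A.
have [k Ak] : exists k, A <= k%:R.
  exists (Num.bound `|A|); apply/ltW/(le_lt_trans (ler_norm _)).
  exact: archi_boundP.
exists (u k).2.+1 => // i /= ki; apply: le_trans Ak _.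
rewrite pmulrn ler_int.
have [_ _] := u_chain k i (leq_trans (u_ge k) (ltnW ki)); apply.
by rewrite ki u_ge.
Qed.

Lemma limit_in_G (u : nat -> truncation) :
  (forall k, positive_tail (u k).1) ->
  (forall k, prolongs k (u k) (u k.+1)) ->
  (forall k, (u k).2 < (u k.+1).2)%N ->
  exists2 beta : R, G beta & (value (u k) : R) @[k --> \oo] --> beta.
Proof.
move=> u_gt0 u_prolongs u_lt.
have [a [a_gt0 a_oo agree]] := limit_digits _ u_gt0 u_prolongs u_lt.
have a_cvg := is_cvg_convergent (R := R) _ a_gt0.
exists (limn (convergent R a)); first by right; exists a.
have -> : (fun k => value (u k)) = convergent R a \o (fun k => (u k).2).
  by apply/funext => k /=; apply: eq_convergent => i /agree.
apply: cvg_comp a_cvg => P [N _ NP]; exists N => // k /= Nk; apply: NP => /=.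
apply: (leq_trans Nk).
by elim: k {Nk} => // k /leq_ltn_trans; apply.
Qed.

End Rounds.

Theorem theorem1 (R : realType) (alpha : R) :
  exists beta gamma : R, G beta /\ G gamma /\ alpha = beta + gamma.
Proof.
have [rat|irr] := pselect (rational alpha).
  exists alpha, 0; rewrite addr0; split; first by left.
  by split=> //; left; exists 0 => //; rewrite rmorph0.
have [p0 ready0] := ready_start alpha irr.
have /choice[next nextP] : forall kp : nat * (truncation * truncation),
    exists p', ready_pair alpha kp.1.+2%:R kp.2 ->
      ready_pair alpha kp.1.+3%:R p' /\ advances kp.1 kp.2 p'.
  move=> [k p]; have [/(ready_pair_round _ _ _ irr)[p' p'P]|] :=
      pselect (ready_pair alpha k.+2%:R p); last by exists p.
  by exists p'.
(* Stage [k] runs with the bound [w = k + 2], as [ready_start] provides [w = 2]. *)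
pose u := fix u k := if k is l.+1 then next (l, u l) else p0.
have u_ready k : ready_pair alpha k.+2%:R (u k).
  by elim: k => [//|k /(nextP (k, u k))[]].
have u_advances k : advances k (u k) (u k.+1).
  by have [] := nextP (k, u k) (u_ready k).
have tails k : positive_tail (u k).1.1 /\ positive_tail (u k).2.1.
  by have [[[]]|[[]]] := u_ready k.
have [beta Gbeta cvg_beta] : exists2 beta : R, G beta &
    (value (u k).1 : R) @[k --> \oo] --> beta.
  by apply: limit_in_G => k; have [] := u_advances k; have [] := tails k.
have [gamma Ggamma cvg_gamma] : exists2 gamma : R, G gamma &
    (value (u k).2 : R) @[k --> \oo] --> gamma.
  by apply: limit_in_G => k; have [] := u_advances k; have [] := tails k.
exists beta, gamma; split=> //; split=> //.
have cvg_sum : (fun k => value (u k).1 + value (u k).2 : R) @ \oo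
    --> beta + gamma by exact: cvgD.
have cvg_alpha : (fun k => value (u k).1 + value (u k).2 : R) @ \oo --> alpha.
  apply/cvgrPdist_le => e e_gt0.
  have /cvgrPdist_le/(_ e e_gt0) := @cvg_harmonic R.
  apply: filterS => k; rewrite sub0r normrN ger0_norm ?harmonic_ge0 //.
  exact/le_trans/ready_approx.
rewrite -(cvg_lim (@Rhausdorff R) cvg_sum).
by rewrite (cvg_lim (@Rhausdorff R) cvg_alpha).
Qed.
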